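(* Let $\mathcal T=[\mathbf A,\mathbf B,\mathbf C]_R$ with $\mathbf A\in\mathbb F^{I\times R}$, $\mathbf B\in\mathbb F^{J\times R}$, $\mathbf C\in\mathbb F^{K\times R}$, and let $m:=R-r_{\mathbf C}+2$. Assume that (i) $\max\bigl(\min(k_{\mathbf A},k_{\mathbf B}-1),\ \min(k_{\mathbf A}-1,k_{\mathbf B})\bigr)+k_{\mathbf C}\ge R+1$; (ii) for every $\mathbf d\in\mathbb F^R$, if $(\mathcal C_m(\mathbf A)\odot\mathcal C_m(\mathbf B))\,\widehat{\mathbf d}^m=\mathbf 0$, then $\widehat{\mathbf d}^m=\mathbf 0$. Then $r_{\mathcal T}=R$ and the CPD of $\mathcal T$ is unique.
   Context: $\mathbb F$ is $\mathbb R$ or $\mathbb C$. For matrices $\mathbf A,\mathbf B,\mathbf C$ with $R$ nonzero columns each, $[\mathbf A,\mathbf B,\mathbf C]_R:=\sum_{r=1}^R\mathbf a_r\circ\mathbf b_r\circ\mathbf c_r$ ($\circ$ = outer product). The rank $r_{\mathcal T}$ of a tensor is the minimal number of terms in such a representation; a representation with $R=r_{\mathcal T}$ terms is a canonical polyadic decomposition (CPD). The CPD of a tensor $\mathcal T$ of rank $R$ is unique if $\mathcal T=[\mathbf A,\mathbf B,\mathbf C]_R=[\bar{\mathbf A},\bar{\mathbf B},\bar{\mathbf C}]_R$ implies that there are an $R\times R$ permutation matrix $\mathbf\Pi$ and nonsingular diagonal matrices $\mathbf\Lambda_{\mathbf A},\mathbf\Lambda_{\mathbf B},\mathbf\Lambda_{\mathbf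 C}$ with $\bar{\mathbf A}=\mathbf A\mathbf\Pi\mathbf\Lambda_{\mathbf A}$, $\bar{\mathbf B}=\mathbf B\mathbf\Pi\mathbf\Lambda_{\mathbf B}$, $\bar{\mathbf C}=\mathbf C\mathbf\Pi\mathbf\Lambda_{\mathbf C}$, $\mathbf\Lambda_{\mathbf A}\mathbf\Lambda_{\mathbf B}\mathbf\Lambda_{\mathbf C}=\mathbf I_R$. $r_{\mathbf M}$ is the rank of a matrix $\mathbf M$; its $k$-rank $k_{\mathbf M}$ is the largest $k$ such that every set of $k$ columns of $\mathbf M$ is linearly independent. $\odot$ is the Khatri-Rao (column-wise Kronecker) product. For $\mathbf M\in\mathbb F^{p\times R}$ the $k$-th compound matrix $\mathcal C_k(\mathbf M)$ is the $\binom pk\times\binom Rk$ matrix of all $k\times k$ minors of $\mathbf M$, with row and column index sets ordered lexicographically; it is defined for $k\le\min(p,R)$, and a hypothesis involving compound matrices is understood to include that they are defined. For $\mathbf d=[d_1\ \dots\ d_R]^T$, $\widehat{\mathbf d}^m\in\mathbb F^{\binom Rm}$ is the vector of all products $d_{i_1}\cdots d_{i_m}$, $1\le i_1<\dots<i_m\le R$, in lexicographic order. *)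

(* Defs.v *)
From mathcomp Require Import all_boot all_order all_algebra.
From mathcomp Require Import complex mxtens.
From mathcomp Require Import reals.

Set Implicit Arguments.
Unset Strict Implicit.
Unset Printing Implicit Defensive.

Import Order.TTheory GRing.Theory Num.Theory.
Local Open Scope ring_scope.

Inductive real_or_complex : fieldType -> Prop :=
| IsReal (K : realType) : real_or_complex K
| IsComplex (K : realType) : real_or_complex (complex K).

(* The i-th k-element subset of {0, .., n-1} in lexicographic order, as the
   increasing tuple of its elements: [Order.enum_val] follows the order of the
   type, which is lexicographic on [k.-tuplelexi 'I_n]. *)
Definition lex_subset (n k : nat) (i : 'I_'C(n, k)) : k.-tuple 'I_n :=
  @Order.enum_val _ (k.-tuplelexi 'I_n)
    [set t : k.-tuple 'I_n | sorted ltn (map val t)]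
    (cast_ord (esym (card_ltn_sorted_tuples k n)) i).

Fact lex_subset_sorted (n k : nat) (i : 'I_'C(n, k)) :
  sorted ltn (map val (lex_subset i)).
Proof.
have := @Order.enum_valP _ (k.-tuplelexi 'I_n)
  [set t : k.-tuple 'I_n | sorted ltn (map val t)]
  (cast_ord (esym (card_ltn_sorted_tuples k n)) i).
by rewrite inE.
Qed.

Fact lex_subset_lt (n k : nat) :
  {homo @lex_subset n k :
    i j / (i < j)%N >-> (i < j :> k.-tuplelexi 'I_n)%O}.
Proof.
move=> i j ij; rewrite /lex_subset.
set D := [set t | _]; set f := cast_ord _.
have mono : {mono (@Order.enum_val _ (k.-tuplelexi 'I_n) D) :
    x y / (x <= y)%O >-> (x <= y)%O}.
  by apply: Order.le_enum_val; exact: le_total.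
by rewrite (leW_mono mono).
Qed.

Section Matrices.

Variable F : fieldType.

(* Beyond the number R of columns the condition on the sets of k columns is
   vacuous, hence the bound k <= R. *)
Definition k_rank (p R : nat) (M : 'M[F]_(p, R)) : nat :=
  \max_(k < R.+1 | [forall S : {set 'I_R}, (#|S| == k) ==>
      row_free (colsub (fun i : 'I_#|S| => enum_val i) M)^T]) k.

(* For k > minn p R, where compound matrices are usually not defined, this
   matrix has no row or no column. *)
Definition compound (k p R : nat) (M : 'M[F]_(p, R)) :
    'M[F]_('C(p, k), 'C(R, k)) :=
  \matrix_(i, j) \det (mxsub (tnth (lex_subset i)) (tnth (lex_subset j)) M).

Definition khatri_rao (p q R : nat) (A : 'M[F]_(p, R)) (B : 'M[F]_(q, R)) :
    'M[F]_(p * q, R) :=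
  \matrix_(i, r) (col r A *t col r B) i 0.

Definition hat (m R : nat) (d : 'cV[F]_R) : 'cV[F]_'C(R, m) :=
  \col_i \prod_(j < m) d (tnth (lex_subset i) j) 0.

Definition nonzero_cols (p R : nat) (M : 'M[F]_(p, R)) : Prop :=
  forall r, col r M != 0.

End Matrices.

Section Tensors.

Variables (F : fieldType) (I J K : nat).

Definition tensor : Type := {ffun 'I_I * 'I_J * 'I_K -> F}.

Definition outer (a : 'cV[F]_I) (b : 'cV[F]_J) (c : 'cV[F]_K) : tensor :=
  [ffun t => a t.1.1 0 * b t.1.2 0 * c t.2 0].

Definition is_pd (T : tensor) (R : nat)
    (A : 'M[F]_(I, R)) (B : 'M[F]_(J, R)) (C : 'M[F]_(K, R)) : Prop :=
  [/\ nonzero_cols A, nonzero_cols B, nonzero_cols C &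
      T = \sum_(r < R) outer (col r A) (col r B) (col r C)].

Definition has_rank (T : tensor) (R : nat) : Prop :=
  (exists A B C, @is_pd T R A B C) /\
  (forall (R' : nat) A B C, @is_pd T R' A B C -> (R <= R')%N).

Definition cpd_unique (T : tensor) : Prop :=
  forall R : nat, has_rank T R ->
  forall (A A' : 'M[F]_(I, R)) (B B' : 'M[F]_(J, R)) (C C' : 'M[F]_(K, R)),
  is_pd T A B C -> is_pd T A' B' C' ->
  exists P LA LB LC : 'M[F]_R,
    [/\ is_perm_mx P,
        [/\ is_diag_mx LA, is_diag_mx LB & is_diag_mx LC],
        [/\ LA \in unitmx, LB \in unitmx & LC \in unitmx],
        [/\ A' = A *m P *m LA, B' = B *m P *m LB & C' = C *m P *m LC] &
        LA *m LB *m LC = 1%:M].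

End Tensors.

(* Main.v *)
(** Contracting the tensor with a vector [u] gives the matrix
    [A diag(C^T u) B^T]. By the Cauchy-Binet formula, condition (ii) says that
    [rank (A diag(d) B^T) >= m] as soon as [d] has [m] nonzero entries, hence
    [rank (A diag(d) B^T) >= min (w(d), m)] where [w(d)] is the number of
    nonzero entries of [d]. For another decomposition [A', B', C'] with at most
    [R] terms this yields [min (w(C^T u), m) <= w(C'^T u)] for all [u].

    This is the hypothesis of Kruskal's permutation lemma. It compares, for
    every flat spanned by columns of [C'], the number of columns of [C] and of
    [C'] that it contains; the comparison holds for hyperplanes and descends to
    smaller flats by a pencil argument. The flat [0] shows that there are
    exactly [R] terms, and the lines show that [C'] is [C] up to permutation
    and scaling.

    Once [C' = C], take [u] such that [C^T u] is supported in a set [S] of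
    [R - k_C + 1] columns. Comparing row spaces puts the columns of [B'] indexed
    by the support in the span of those of [B]. Intersecting over the sets [S]
    inside a set of size [R - k_C + 2 <= k_B] containing [r] shows that [b'_r]
    is a multiple of [b_r], which then determines [a'_r]. *)

Require Import Defs.
From mathcomp Require Import all_boot all_order all_algebra.
From mathcomp Require Import all_fingroup mxtens zify.

Set Implicit Arguments.
Unset Strict Implicit.
Unset Printing Implicit Defensive.

Import Order.TTheory GRing.Theory Num.Theory.
Local Open Scope ring_scope.

(** * Subsets in lexicographic order and the Cauchy-Binet formula *)

Lemma lex_subset_inj (n k : nat) : injective (@lex_subset n k).
Proof.
move=> i j eq_ij; apply/val_inj/eqP; case: ltngtP => // /lex_subset_lt;
  by rewrite eq_ij ltxx.
Qed.

Lemma lex_subset_tnth_inj (n k : nat) (i : 'I_'C(n, k)) :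
  injective (tnth (lex_subset i)).
Proof.
apply/tuple_uniqP; rewrite -(map_inj_uniq val_inj).
exact: (sorted_uniq ltn_trans ltnn (lex_subset_sorted i)).
Qed.

(** An injection is the increasing enumeration of its image composed with a permutation; this
    bijection splits the sum over injections in [Cauchy_Binet]. *)
Definition lex_perm (n k : nat) (p : 'I_'C(n, k) * 'S_k) :
  {ffun 'I_k -> 'I_n} := [ffun i => tnth (lex_subset p.1) (p.2 i)].

Lemma mem_lex_subset (n k : nat) (p : 'I_'C(n, k) * 'S_k) x :
  (x \in lex_subset p.1) = (x \in codom (lex_perm p)).
Proof.
apply/tnthP/codomP => [[i ->]|[i ->]]; last by exists (p.2 i); rewrite ffunE.
by exists ((p.2)^-1 i)%g; rewrite ffunE permKV.
Qed.

Lemma lex_perm_inj (n k : nat) : injective (@lex_perm n k).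
Proof.
move=> [i s] [j t] eq_h.
have eq_ij : i = j.
  apply: lex_subset_inj; apply: val_inj; apply: (inj_map val_inj).
  apply: (irr_sorted_eq ltn_trans ltnn) => [||x]; try exact: lex_subset_sorted.
  by apply/mapP/mapP => -[y yi ->]; exists y => //; move: yi;
    rewrite -?(mem_lex_subset (i, s)) ?(mem_lex_subset (j, t)) -?eq_h;
    rewrite ?(mem_lex_subset (i, s)).
rewrite -eq_ij in eq_h *; congr pair; apply/permP => x.
by move/ffunP/(_ x): eq_h; rewrite !ffunE => /lex_subset_tnth_inj.
Qed.

(** Given [lex_perm_inj], it suffices to count: a binomial coefficient times a factorial is a
    falling factorial. *)
Lemma lex_perm_onto (n k : nat) :
  @lex_perm n k @: [set: _] = [set f : {ffun 'I_k -> 'I_n} | injectiveb f].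
Proof.
apply/eqP; rewrite eqEcard; apply/andP; split.
  apply/subsetP => _ /imsetP [p _ ->]; rewrite inE; apply/injectiveP => x y.
  by rewrite !ffunE => /lex_subset_tnth_inj/perm_inj.
rewrite card_imset; last exact: lex_perm_inj.
by rewrite cardsT card_prod card_Sn card_inj_ffuns !card_ord bin_ffact.
Qed.

(** Multilinear expansion gives a sum over all maps [f]. A non-injective [f] repeats a row of [Y];
    the injective ones with a common image add up to a product of two minors. *)
Theorem Cauchy_Binet (R : comNzRingType) (n k : nat)
    (X : 'M[R]_(k, n)) (Y : 'M[R]_(n, k)) :
  \det (X *m Y) = \sum_(j < 'C(n, k))
    \det (colsub (tnth (lex_subset j)) X) *
    \det (rowsub (tnth (lex_subset j)) Y).
Proof.
transitivity (\sum_(f : {ffun 'I_k -> 'I_n})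
    (\prod_i X i (f i)) * \det (rowsub f Y)).
  under eq_bigr => f _ do rewrite big_distrr /=.
  rewrite exchange_big; apply: eq_bigr => /= s _.
  transitivity ((-1) ^+ s *
      \sum_(f : {ffun 'I_k -> 'I_n}) \prod_i (X i (f i) * Y (f i) (s i))).
    congr (_ * _); rewrite -(bigA_distr_bigA (fun i j => X i j * Y j (s i))).
    by apply: eq_bigr => i _; rewrite mxE.
  rewrite big_distrr; apply: eq_bigr => f _ /=.
  rewrite mulrCA -big_split; congr (_ * _).
  by apply: eq_bigr => i _; rewrite mxE.
rewrite (bigID (fun f : {ffun _} => injectiveb f)) /= addrC.
rewrite big1 ?add0r; last first.
  move=> f /injectivePn [i1 [i2 ne12 eq12]].
  by rewrite (determinant_alternate ne12) ?mulr0 // => j; rewrite !mxE eq12.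
rewrite (eq_bigl (mem (@lex_perm n k @: [set: _]))); last first.
  by move=> f; rewrite lex_perm_onto /= inE.
rewrite big_imset /=; last by move=> p q _ _; exact: lex_perm_inj.
rewrite (eq_bigl xpredT) => [|p]; last by rewrite inE.
rewrite -(pair_bigA _ (fun j s => \prod_i X i (lex_perm (j, s) i) *
  \det (rowsub (lex_perm (j, s)) Y))) /=.
apply: eq_bigr => j _; rewrite big_distrl; apply: eq_bigr => s _ /=.
have -> : rowsub (lex_perm (j, s)) Y =
    row_perm s (rowsub (tnth (lex_subset j)) Y).
  by apply/matrixP => a b; rewrite !mxE ffunE.
rewrite row_permE det_mulmx det_perm mulrA; congr (_ * _); rewrite mulrC.
by congr (_ * _); apply: eq_bigr => i _; rewrite mxE ffunE.
Qed.

(** * Subsets of prescribed cardinality *)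

Lemma exists_subset_card (T : finType) (X : {set T}) (k : nat) :
  (k <= #|X|)%N -> exists2 Y : {set T}, Y \subset X & #|Y| = k.
Proof.
move=> le_kX; exists [set x in take k (enum X)].
  by apply/subsetP => x; rewrite inE => /mem_take; rewrite mem_enum.
rewrite cardsE (card_uniqP _) ?take_uniq ?enum_uniq //.
by rewrite size_takel // -cardE.
Qed.

Lemma exists_between_card (T : finType) (X Z : {set T}) (k : nat) :
  X \subset Z -> (#|X| <= k <= #|Z|)%N ->
  exists Y : {set T}, [/\ X \subset Y, Y \subset Z & #|Y| = k].
Proof.
move=> sXZ /andP[Xk kZ].
have [|Y sY cY] := @exists_subset_card _ (Z :\: X) (k - #|X|).
  by rewrite cardsD (setIidPr sXZ) leq_sub2r.
exists (X :|: Y); rewrite subsetUl subUset sXZ (subset_trans sY) ?subsetDl //.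
split=> //; rewrite cardsU cY disjoint_setI0 ?cards0 ?subn0 ?subnKC //.
by rewrite disjoint_sym (disjointWl sY) // disjoints_subset subsetDr.
Qed.

(** * Rank of [A *m diag_mx d *m B^T], compound matrices and k-ranks *)

Section RankBounds.
Variable F : fieldType.

Definition supp (n : nat) (d : 'rV[F]_n) : {set 'I_n} :=
  [set i | d 0 i != 0].

Lemma supp_notin (n : nat) (d : 'rV[F]_n) (S : {set 'I_n}) i :
  supp d \subset S -> i \notin S -> d 0 i = 0.
Proof.
by move=> /subsetP sS; apply: contraNeq => di; apply: sS; rewrite inE.
Qed.

Lemma rank_diag_le (n : nat) (d : 'rV[F]_n) :
  (\rank (diag_mx d) <= #|supp d|)%N.
Proof.
rewrite diag_mx_sum_delta (bigID (mem (supp d))) /= addrC big1 ?add0r.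
  rewrite -sum1_card; elim/big_ind2: _ => [|M x N y Mx Ny|i _].
  - by rewrite mxrank0.
  - exact: leq_trans (mxrank_add _ _) (leq_add Mx Ny).
  - by rewrite (leq_trans (mxrank_scale _ _)) // mxrank_delta.
by move=> i; rewrite inE negbK => /eqP ->; rewrite scale0r.
Qed.

Lemma det_mxsub_eq0 (p q m : nat) (M : 'M[F]_(p, q))
    (f : 'I_m -> 'I_p) (g : 'I_m -> 'I_q) :
  (\rank M < m)%N -> \det (mxsub f g M) = 0.
Proof.
move=> ltM; apply: contraTeq ltM => det_n0; rewrite -leqNgt.
have : row_free (mxsub f g M) by rewrite row_free_unit unitmxE unitfE.
rewrite /row_free => /eqP {1}<-.
have -> : mxsub f g M = rowsub f 1%:M *m M *m colsub g 1%:M.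
  by rewrite -mulmxA mulmx_colsub mulmx1 -rowsubE mxsubrc.
exact: leq_trans (mxrankM_maxl _ _) (mxrankM_maxr _ _).
Qed.

Lemma mxE_pencil (p q R : nat) (A : 'M[F]_(p, R)) (B : 'M[F]_(q, R)) d i j :
  (A *m diag_mx d *m B^T) i j = \sum_r d 0 r * (A i r * B j r).
Proof.
rewrite mxE; apply: eq_bigr => r _; rewrite mul_mx_diag !mxE.
by rewrite mulrCA mulrA.
Qed.

(** By Cauchy-Binet, the entries of this vector are the minors of order [m] of
    [A *m diag_mx d *m B^T]. *)
Lemma compound_hat_eq0 (p q R m : nat) (A : 'M[F]_(p, R)) (B : 'M[F]_(q, R))
    (d : 'rV[F]_R) :
  (\rank (A *m diag_mx d *m B^T) < m)%N ->
  khatri_rao (compound m A) (compound m B) *m hat m d^T = 0.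
Proof.
move=> rank_lt; apply/matrixP => i c; rewrite ord1 [RHS]mxE {c}.
rewrite -[i]mxtens_unindexK; case: (mxtens_unindex i) => a b {i}.
set X := rowsub (tnth (lex_subset a)) A.
set Y := rowsub (tnth (lex_subset b)) B.
transitivity (\det (X *m (diag_mx d *m Y^T))).
  rewrite Cauchy_Binet mxE; apply: eq_bigr => j _.
  have -> : rowsub (tnth (lex_subset j)) (diag_mx d *m Y^T) =
      diag_mx (\row_k d 0 (tnth (lex_subset j) k)) *m
      (colsub (tnth (lex_subset j)) Y)^T.
    by apply/matrixP => x y; rewrite !mul_diag_mx !mxE.
  rewrite det_mulmx det_diag det_tr !mxE mxtens_indexK -mulrA -!mxsubcr.
  rewrite [X in _ = _ * X]mulrC; congr (_ * (_ * _)).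
  by apply: eq_bigr => k _; rewrite !mxE.
have -> : X *m (diag_mx d *m Y^T) =
    mxsub (tnth (lex_subset a)) (tnth (lex_subset b)) (A *m diag_mx d *m B^T).
  apply/matrixP => x y; rewrite mulmxA [RHS]mxE !mxE_pencil.
  by apply: eq_bigr => r _; rewrite !mxE.
exact: det_mxsub_eq0.
Qed.

Lemma hat_neq0 (R m : nat) (d : 'rV[F]_R) :
  (m <= #|supp d|)%N -> hat m d^T != 0.
Proof.
move=> le_md.
(* The map [f] lists [m] elements of the support; [lex_perm_onto] finds the lexicographic index of
   their set, where the entry of [hat] is nonzero. *)
pose f := [ffun i : 'I_m => enum_val (widen_ord le_md i)].
have : f \in @lex_perm R m @: [set: _].
  rewrite lex_perm_onto inE; apply/injectiveP => i j.
  by rewrite !ffunE => /enum_val_inj/(congr1 val) /= /ord_inj.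
case/imsetP => p _ def_f; apply/negP => /eqP/colP/(_ p.1)/eqP.
rewrite !mxE; apply/negP/prodf_neq0 => i _; rewrite mxE.
have /codomP[k ->] : tnth (lex_subset p.1) i \in codom (lex_perm p).
  by rewrite -mem_lex_subset mem_tnth.
rewrite -def_f ffunE.
by have := enum_valP (widen_ord le_md k); rewrite inE.
Qed.

Lemma rank_pencil_ge (p q R m : nat) (A : 'M[F]_(p, R)) (B : 'M[F]_(q, R))
    (d : 'rV[F]_R) :
  (m <= R)%N ->
  (forall e : 'cV[F]_R,
     khatri_rao (compound m A) (compound m B) *m hat m e = 0 -> hat m e = 0) ->
  (minn #|supp d| m <= \rank (A *m diag_mx d *m B^T))%N.
Proof.
move=> le_mR Um.
have Um_rank e : (m <= #|supp e|)%N -> (m <= \rank (A *m diag_mx e *m B^T))%N.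
  move=> /hat_neq0; apply: contraNT; rewrite -ltnNge => /compound_hat_eq0.
  by move=> /Um ->.
have [/Um_rank // |] := leqP m #|supp d|.
move=> lt_dm.
have [|E sE cE] := @exists_subset_card _ (~: supp d) (m - #|supp d|).
  by rewrite [leqRHS]cardsCs setCK card_ord leq_sub2r.
(* Enlarging the support of [d] to [m] elements raises the rank by at most the
   number of new elements. *)
pose e : 'rV[F]_R := \row_i (i \in E)%:R.
have supp_e : supp e = E.
  by apply/setP => i; rewrite inE mxE; case: (i \in E); rewrite ?oner_eq0 ?eqxx.
have supp_de : supp (d + e) = supp d :|: E.
  apply/setP => i; rewrite !inE !mxE; case: (boolP (i \in E)) => [iE|_].
    move/subsetP/(_ _ iE): sE; rewrite !inE negbK => /eqP ->.
    by rewrite add0r oner_eq0 eqxx.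
  by rewrite addr0 orbF.
have := @Um_rank (d + e); rewrite supp_de cardsU disjoint_setI0; last first.
  by rewrite disjoint_sym disjoints_subset.
rewrite cards0 subn0 cE subnKC ?(ltnW lt_dm) // => /(_ (leqnn _)).
have -> : diag_mx (d + e) = diag_mx d + diag_mx e by rewrite raddfD.
rewrite mulmxDr mulmxDl => /leq_trans/(_ (mxrank_add _ _)).
have : (\rank (A *m diag_mx e *m B^T) <= #|E|)%N.
  rewrite -supp_e (leq_trans _ (rank_diag_le e)) //.
  exact: leq_trans (mxrankM_maxl _ _) (mxrankM_maxr _ _).
rewrite cE; lia.
Qed.

Lemma k_rank_le (p R : nat) (M : 'M[F]_(p, R)) : (k_rank M <= R)%N.
Proof. by apply/bigmax_leqP => i _; rewrite -ltnS. Qed.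

(** The support of [v] extends to a set of exactly [k_rank M] columns, and these are independent. *)
Lemma k_rank_ker (p R : nat) (M : 'M[F]_(p, R)) (v : 'cV[F]_R) :
  (#|supp v^T| <= k_rank M)%N -> M *m v = 0 -> v = 0.
Proof.
move=> le_v Mv0.
have [k free_k def_k] : {k : 'I_R.+1 | [forall S : {set 'I_R}, (#|S| == k) ==>
    row_free (colsub (fun i : 'I_#|S| => enum_val i) M)^T] & k_rank M = k}.
  (* The maximum is attained because [0] is admissible. *)
  apply: eq_bigmax_cond; apply/card_gt0P; exists ord0.
  apply/forallP => S; apply/implyP => /eqP S0; rewrite /row_free.
  by rewrite eqn_leq rank_leq_row [leqLHS]S0.
have [|S [sS _ cS]] := exists_between_card (subsetT (supp v^T)) (k := k).
  by rewrite -def_k le_v cardsT card_ord k_rank_le.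
have {free_k} free_S := implyP (forallP free_k S) (introT eqP cS).
have : (rowsub (fun i : 'I_#|S| => enum_val i) v)^T = 0.
  apply/eqP; rewrite -(mulmx_free_eq0 _ free_S) -trmx_mul; apply/eqP.
  rewrite -[RHS]trmx0 -Mv0; congr (_^T); apply/matrixP => i j; rewrite !mxE.
  rewrite [RHS](bigID (mem S)) /= [X in _ = _ + X]big1 ?addr0.
    by rewrite [RHS]big_enum_val; apply: eq_bigr => x _; rewrite !mxE.
  move=> r rS; have := supp_notin sS rS; rewrite mxE ord1 => ->.
  by rewrite mulr0.
move=> v_S; apply/colP => i; rewrite mxE.
have [iS|iS] := boolP (i \in S); last by have := supp_notin sS iS; rewrite mxE.
move/rowP/(_ (enum_rank_in iS i)): v_S.
by rewrite !mxE enum_rankK_in.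
Qed.

(** The columns of [diag_mx d *m X] are supported in [supp d], and [A] is injective on such vectors
    by [k_rank_ker]. *)
Lemma rank_mul_k_rank (p q R : nat) (A : 'M[F]_(p, R)) (d : 'rV[F]_R)
    (X : 'M[F]_(R, q)) :
  (#|supp d| <= k_rank A)%N ->
  \rank (A *m (diag_mx d *m X)) = \rank (diag_mx d *m X).
Proof.
move=> le_d; rewrite -mxrank_tr trmx_mul -[RHS]mxrank_tr.
rewrite -[RHS](mxrank_mul_ker _ A^T).
suff -> : ((diag_mx d *m X)^T :&: kermx A^T)%MS = 0 by rewrite mxrank0 addn0.
apply/eqP/rowV0P => u; rewrite sub_capmx.
case/andP => /submxP[w def_u] /sub_kermxP uA.
rewrite trmx_mul tr_diag_mx mulmxA in def_u.
apply: trmx_inj; rewrite trmx0; apply: (k_rank_ker (M := A)).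
  rewrite trmxK (leq_trans _ le_d) // subset_leq_card //.
  apply/subsetP => i; rewrite !inE def_u mul_mx_diag mxE.
  by apply: contraNneq => ->; rewrite mulr0.
by apply: trmx_inj; rewrite trmx_mul trmxK uA trmx0.
Qed.

End RankBounds.

(** * Kruskal's permutation lemma, for the rows of two matrices *)

Section PermutationLemma.
Variable F : fieldType.

Lemma mulmx_col (p q r : nat) (X : 'M[F]_(p, q)) (Y : 'M[F]_(q, r)) j :
  X *m col j Y = col j (X *m Y).
Proof. by rewrite !colE mulmxA. Qed.

(** Some column of [cokermx V] is not killed by [M]. *)
Lemma exists_separating (p q r : nat) (M : 'M[F]_(p, r)) (V : 'M[F]_(q, r)) :
  ~~ (M <= V)%MS -> exists2 u : 'cV[F]_r, V *m u = 0 & M *m u != 0.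
Proof.
rewrite submxE => nz.
have /existsP[j nz_j] : [exists j, col j (M *m cokermx V) != 0].
  apply: contraNT nz => /existsPn all0; apply/eqP/matrixP => i j.
  have := all0 j; rewrite negbK => /eqP/colP/(_ i).
  by rewrite !mxE.
exists (col j (cokermx V)); last by rewrite mulmx_col.
by rewrite mulmx_col mulmx_coker; apply/colP => k; rewrite !mxE.
Qed.

Lemma addsmx_exchange (K : nat) (V : 'M[F]_K) (x y : 'rV[F]_K) :
  (x <= V + y)%MS -> ~~ (x <= V)%MS -> (V + x :=: V + y)%MS.
Proof.
move=> xVy xV; apply/eqmxP.
rewrite -(geq_leqif (mxrank_leqif_eq _)); last by rewrite addsmx_sub addsmxSl.
have /mxrank_leqif_sup/ltn_leqif := addsmxSl V x.
rewrite addsmx_sub submx_refl xV /= => lt_V.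
apply: leq_trans lt_V; apply: leq_trans (mxrank_adds_leqif _ _) _.
by rewrite (leq_trans (leq_add (leqnn _) (rank_leq_row _))) ?addn1.
Qed.

Lemma sum_card_exchange (T U : finType) (P : {set T}) (f : T -> {set U}) :
  \sum_(i in P) #|f i| = \sum_u #|[set i in P | u \in f i]|.
Proof.
under eq_bigr => i _ do rewrite -sum1_card big_mkcond.
rewrite exchange_big; apply: eq_bigr => u _ /=.
by rewrite -sum1_card -big_mkcondr; apply: eq_bigl => i; rewrite inE.
Qed.

Definition rows_in (K R : nat) (V : 'M[F]_K) (N : 'M[F]_(R, K)) : {set 'I_R} :=
  [set r | (row r N <= V)%MS].

Variables (K R R' m : nat) (N : 'M[F]_(R, K)) (N' : 'M[F]_(R', K)).
Hypothesis def_m : m = (R - \rank N + 2)%N.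
Hypothesis supp_le : forall u : 'cV[F]_K,
  (minn #|supp (N *m u)^T| m <= #|supp (N' *m u)^T|)%N.

Lemma supp0 (n : nat) (v : 'cV[F]_n) : #|supp v^T| = 0%N -> v = 0.
Proof.
move/eqP; rewrite cards_eq0 => /eqP/setP v0.
by apply/colP => i; have := v0 i; rewrite !inE !mxE => /negbFE/eqP.
Qed.

(** A vector [u] killed by [N'] but not by [N] would violate [supp_le], since [m] is positive. *)
Lemma submx_permutation : (N <= N')%MS.
Proof.
apply: contraTT isT => /exists_separating[u N'u]; case/eqP; apply: supp0.
have := supp_le u; rewrite N'u.
have -> : supp (0 : 'cV[F]_R')^T = set0.
  by apply/setP => k; rewrite !inE !mxE eqxx.
by rewrite cards0 def_m addn2 geq_min orbF leqn0 => /eqP.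
Qed.

Hypothesis le_R'R : (R' <= R)%N.

(** A vector [u] vanishing on [V] but not on [N'] cuts out exactly [V] in the row space of [N'], so
    supports count the rows outside [V]. At most [R - \rank N + 1 < m] rows of [N'] lie outside, so
    the minimum in [supp_le] is the support for [N]. *)
Lemma card_rows_in_hyperplane (V : 'M[F]_K) :
  (V <= N')%MS -> \rank N' = (\rank V).+1 -> (\rank V <= #|rows_in V N'|)%N ->
  (#|rows_in V N'| + (R - R') <= #|rows_in V N|)%N.
Proof.
move=> VN' rN' rV.
have [|u Vu N'u] := @exists_separating _ _ _ N' V.
  by apply: contraTN isT => /mxrankS; rewrite rN' ltnn.
have eqV : ((N' :&: kermx u)%MS :=: V)%MS.
  apply/eqmx_sym/eqmxP.
  rewrite -(geq_leqif (mxrank_leqif_eq _)); last first.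
    by rewrite sub_capmx VN'; apply/sub_kermxP.
  have := mxrank_mul_ker N' u; rewrite rN'.
  have : (0 < \rank (N' *m u))%N by rewrite lt0n mxrank_eq0.
  lia.
have inV (x : 'rV_K) : (x <= N')%MS -> (x <= V)%MS = (x *m u == 0).
  by move=> xN'; rewrite -eqV sub_capmx xN'; apply/sub_kermxP/eqP.
have count p (M : 'M_(p, K)) :
    (M <= N')%MS -> (#|rows_in V M| + #|supp (M *m u)^T|)%N = p.
  move=> MN'.
  rewrite -[RHS]card_ord -(cardsC (rows_in V M)).
  congr (_ + #|pred_of_set _|)%N.
  apply/setP => r; rewrite !inE !mxE inV ?(submx_trans (row_sub r M)) //.
  rewrite -row_mul; congr (~~ _); apply/eqP/eqP => [ru|/rowP/(_ 0)].
    by apply/rowP => c; rewrite ord1 !mxE -[RHS]ru.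
  by rewrite !mxE.
have cN := count _ _ submx_permutation; have cN' := count _ _ (submx_refl N').
have := supp_le u; have := mxrankS submx_permutation.
have := rank_leq_row N; rewrite def_m rN'; lia.
Qed.

(* [\rank V <= #|rows_in V N'|] weakens "[V] is spanned by rows of [N']", and is
   preserved when a row of [N'] is added to [V]. *)
Lemma card_rows_in_flat (V : 'M[F]_K) :
  (V <= N')%MS -> (\rank V < \rank N')%N -> (\rank V <= #|rows_in V N'|)%N ->
  (#|rows_in V N'| + (R - R') <= #|rows_in V N|)%N.
Proof.
(* Induction on the codimension of [V] in the row space of [N'], starting with hyperplanes. *)
move=> VN' ltV; have [n] := ubnPeq (\rank N' - (\rank V).+1)%N.
move: V VN' ltV.
elim: n => [|n IHn] V VN' ltV def_n rV.
  by apply: card_rows_in_hyperplane => //; lia.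
rewrite leqNgt; apply/negP => lt_V.
(* The flats [L j] through [V] and one further row of [N'] split the rows outside
   [V] into at least two blocks. If the inequality failed for [V], the excess of
   [N] over [N'] outside [V] would be counted once in each block. *)
pose L j := (V + row j N')%MS.
pose out := ~: rows_in V N'.
have outE j : (j \in out) = ~~ (row j N' <= V)%MS by rewrite !inE.
have subL j : rows_in V N' \subset rows_in (L j) N'.
  apply/subsetP => r; rewrite !inE => /submx_trans; apply.
  exact: addsmxSl.
have rankL j : j \in out -> \rank (L j) = (\rank V).+1.
  rewrite outE => xV; apply/eqP; rewrite eqn_leq; apply/andP; split.
    apply: leq_trans (mxrank_adds_leqif _ _) _.
    by rewrite (leq_trans (leq_add (leqnn _) (rank_leq_row _))) ?addn1.
  have /mxrank_leqif_sup/ltn_leqif := addsmxSl V (row j N').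
  by rewrite addsmx_sub submx_refl xV.
have LN' j : (L j <= N')%MS by rewrite addsmx_sub VN' row_sub.
have IHL j : j \in out ->
    (#|rows_in (L j) N'| + (R - R') <= #|rows_in (L j) N|)%N.
  move=> jo; apply: IHn => //; rewrite ?rankL //; try lia.
  apply: leq_ltn_trans rV _; apply: proper_card; rewrite properE subL /=.
  apply/subsetPn; exists j; last by move: jo; rewrite inE.
  by rewrite inE addsmxSr.
(* One index per flat: for [j] in [out], [rep j] depends only on [L j], and the default of [odflt]
   is not reached since [j] itself qualifies. *)
pose rep j := odflt j [pick i in out | (L i == L j)%MS].
have repP j : j \in out -> rep j \in out /\ (L (rep j) :=: L j)%MS.
  rewrite /rep; case: pickP => [i /andP[io /eqmxP ij] _ // | /(_ j)].
  by move=> /= /negbT; rewrite negb_and => /orP[/negP//|]; rewrite !submx_refl.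
have rep_eq i j : (L i :=: L j)%MS -> i \in out -> j \in out -> rep i = rep j.
  move=> eqL io jo; rewrite /rep.
  rewrite (@eq_pick _ _ (fun k => (k \in out) && (L k == L j)%MS)).
    by case: pickP => //= /(_ j); rewrite jo !submx_refl.
  by move=> k /=; rewrite !eqL.
pose P := rep @: out.
have Pout i : i \in P -> i \in out by case/imsetP => j /repP[? _] ->.
have Pinj i j : i \in P -> j \in P -> (L i :=: L j)%MS -> i = j.
  case/imsetP => i' io ->; case/imsetP => j' jo -> eqL.
  have [_ eqi] := repP _ io; have [_ eqj] := repP _ jo.
  apply: rep_eq => //; apply: eqmx_trans (eqmx_sym eqi) _.
  exact: eqmx_trans eqL eqj.
(* Here [V] has codimension at least 2, so some row of [N'] lies outside [L j1]. *)
have cardP : (1 < #|P|)%N.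
  have notsub (W : 'M_K) :
      (\rank W < \rank N')%N -> exists j, ~~ (row j N' <= W)%MS.
    move=> ltW; apply/existsP; rewrite -negb_forall; apply/negP => /forallP sub.
    by move: ltW; rewrite ltnNge mxrankS //; apply/row_subP.
  have [j1 j1V] := notsub V ltV; have j1o : j1 \in out by rewrite outE.
  have [|j2 j2L] := notsub (L j1); first by rewrite rankL //; lia.
  have j2o : j2 \in out.
    by rewrite outE; apply: contra j2L => /submx_trans; apply; exact: addsmxSl.
  apply/card_gt1P; exists (rep j1), (rep j2); split; try exact: imset_f.
  have [_ eq1] := repP _ j1o; have [_ eq2] := repP _ j2o.
  by apply: contraNneq j2L => eq12; rewrite -eq1 eq12 eq2 addsmxSr.
pose B' i := rows_in (L i) N' :\: rows_in V N'.
pose B i := rows_in (L i) N :\: rows_in V N.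
have cardB i : i \in P ->
    (#|B' i| + (#|rows_in V N'| + (R - R') - #|rows_in V N|) <= #|B i|)%N.
  move=> iP; have := IHL i (Pout i iP); rewrite /B /B' !cardsD.
  have := subset_leq_card (subL i); rewrite (setIidPr (subL i)).
  have subLN : rows_in V N \subset rows_in (L i) N.
    by apply/subsetP => r; rewrite !inE => /submx_trans; apply; exact: addsmxSl.
  have := subset_leq_card subLN; rewrite (setIidPr subLN); lia.
(* The blocks of [N] are disjoint: by [addsmx_exchange], a row outside [V] lies in at most one of
   these flats. *)
have sumB : (\sum_(i in P) #|B i| <= R - #|rows_in V N|)%N.
  have -> : (R - #|rows_in V N|)%N = #|~: rows_in V N|.
    by rewrite [RHS]cardsCs setCK card_ord.
  rewrite sum_card_exchange.
  rewrite -sum1_card [leqRHS]big_mkcond; apply: leq_sum => r _.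
  have [rV'|rV'] := boolP (r \in ~: _); last first.
    rewrite leqn0 cards_eq0; apply/eqP/setP => i; rewrite !inE.
    by move: rV'; rewrite !inE negbK => ->; rewrite andbF.
  apply/card_le1_eqP => i j; rewrite !inE in rV' *.
  rewrite rV' => /andP[iP ri] /andP[jP rj]; apply: Pinj => //.
  apply: eqmx_trans (addsmx_exchange ri rV').
  exact: eqmx_sym (addsmx_exchange rj rV').
(* The blocks of [N'] cover its rows outside [V]. *)
have sumB' : (R' - #|rows_in V N'| <= \sum_(i in P) #|B' i|)%N.
  have -> : (R' - #|rows_in V N'|)%N = #|~: rows_in V N'|.
    by rewrite [RHS]cardsCs setCK card_ord.
  rewrite sum_card_exchange.
  rewrite -sum1_card [leqLHS]big_mkcond; apply: leq_sum => r _.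
  case: ifP => // ro; rewrite card_gt0; apply/set0Pn; exists (rep r).
  have [_ eqL] := repP _ ro; rewrite !inE imset_f //= eqL addsmxSr andbT.
  by rewrite -outE.
(* Let [p] and [p'] count the rows of [N] and [N'] in [V], and let [e = p' + (R - R') - p > 0]. The
   blocks give [R' - p' + #|P| * e <= R - p], whose right side is [R' - p' + e]; this contradicts
   [1 < #|P|]. *)
have := leq_sum (index_enum _) cardB.
rewrite big_split /= sum_nat_const.
have := max_card (mem (rows_in V N)); have := max_card (mem (rows_in V N')).
rewrite !card_ord; move: cardP sumB sumB' lt_V.
move: (#|rows_in V N|) (#|rows_in V N'|) (\sum_(i in P) #|B i|)%N
  (\sum_(i in P) #|B' i|)%N #|P| => p p' b b' q q2 bR bR' lt_p le_p' le_p.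
nia.
Qed.

Lemma size_permutation :
  (0 < \rank N)%N -> (forall r, row r N != 0) -> (forall r, row r N' != 0) ->
  R' = R.
Proof.
move=> rN nzN nzN'.
have in0 p (M : 'M_(p, K)) : (forall r, row r M != 0) -> rows_in 0 M = set0.
  by move=> nzM; apply/setP => r; rewrite !inE submx0 (negPf (nzM r)).
have := @card_rows_in_flat 0; rewrite sub0mx mxrank0 !in0 // !cards0.
move=> /(_ isT (leq_trans rN (mxrankS submx_permutation)) isT); lia.
Qed.

End PermutationLemma.

Theorem Kruskal_permutation (F : fieldType) (K R m : nat)
    (N N' : 'M[F]_(R, K)) :
  m = (R - \rank N + 2)%N ->
  (forall u : 'cV[F]_K,
     (minn #|supp (N *m u)^T| m <= #|supp (N' *m u)^T|)%N) ->
  (1 < \rank N)%N -> (forall r, row r N != 0) -> (forall r, row r N' != 0) ->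
  (forall i j, (row i N <= row j N)%MS -> i = j) ->
  exists s : 'S_R, forall j,
    exists2 mu : F, mu != 0 & row j N' = mu *: row (s j) N.
Proof.
move=> def_m supp_le rN nzN nzN' injN.
have leNN' := submx_permutation def_m supp_le.
have card_line j :
    (#|rows_in <<row j N'>>%MS N'| <= #|rows_in <<row j N'>>%MS N|)%N.
  suff : (#|rows_in <<row j N'>>%MS N'| + (R - R) <=
      #|rows_in <<row j N'>>%MS N|)%N by rewrite subnn addn0.
  have rank1 : \rank <<row j N'>>%MS = 1%N by rewrite genmxE rank_rV nzN'.
  apply: (card_rows_in_flat def_m supp_le (leqnn R)).
  - by rewrite genmxE row_sub.
  - by rewrite rank1 (leq_trans rN) // mxrankS.
  - by rewrite rank1; apply/card_gt0P; exists j; rewrite inE genmxE.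
have /fin_all_exists[f fP] (j : 'I_R) : exists r : 'I_R,
    exists2 mu, mu != 0 & row j N' = mu *: row r N.
  have : (0 < #|rows_in <<row j N'>>%MS N|)%N.
    apply: leq_trans (card_line j); apply/card_gt0P; exists j.
    by rewrite inE genmxE.
  case/card_gt0P => r; rewrite inE genmxE => /sub_rVP[a def_r].
  have a0 : a != 0 by apply: contraNneq (nzN r) => a0; rewrite def_r a0 scale0r.
  exists r, a^-1; first by rewrite invr_eq0.
  by rewrite def_r scalerA mulVf ?scale1r.
(* Two rows of [N'] on one line would force, by [card_line], two distinct rows of [N] on it, against
   [injN]. *)
have f_inj : injective f.
  move=> i j eq_f; apply/eqP; apply: wlog_neg => ne_ij.
  have : (1 < #|rows_in <<row i N'>>%MS N|)%N.
    apply: leq_trans (card_line i); apply/card_gt1P; exists i, j.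
    split=> //; rewrite inE genmxE ?submx_refl //.
    have [a a0 ->] := fP i; have [b b0 ->] := fP j; rewrite -eq_f.
    by rewrite (eqmx_scale _ a0) scalemx_sub.
  case/card_gt1P => r1 [r2 []]; rewrite !inE !genmxE.
  move=> /sub_rVP[a def1] /sub_rVP[b def2].
  have b0 : b != 0 by apply: contraNneq (nzN r2) => b0; rewrite def2 b0 scale0r.
  case/eqP; apply: injN.
  by rewrite def1 def2 (eqmx_scale _ b0) scalemx_sub.
exists (perm f_inj) => j; have [mu mu0 ->] := fP j.
by exists mu; rewrite ?permE.
Qed.

(** * Recovery of two factors when the third is known *)

Section Core.
Variable F : fieldType.

Lemma row_diag_mul (p q : nat) (d : 'rV[F]_p) (M : 'M[F]_(p, q)) i :
  row i (diag_mx d *m M) = d 0 i *: row i M.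
Proof. by rewrite row_mul row_diag_mx -scalemxAl -rowE. Qed.

(** The columns of [C] outside [S] together with column [r] number at most [k_rank C], hence are
    independent; a functional can vanish on the former and not on the latter. *)
Lemma exists_vanishing_off (K R : nat) (C : 'M[F]_(K, R)) (S : {set 'I_R}) r :
  r \in S -> (#|~: S| < k_rank C)%N ->
  exists2 u : 'cV[F]_K, supp (C^T *m u)^T \subset S & (C^T *m u) r 0 != 0.
Proof.
move=> rS ltS; pose D : 'M[F]_R := diag_mx (\row_i (i \notin S)%:R).
have : ~~ (row r C^T <= D *m C^T)%MS.
  apply/negP => /submxP[w def_r].
  pose v := (delta_mx 0 r - w *m D)^T.
  have supp_v : supp v^T \subset r |: ~: S.
    apply/subsetP => i; rewrite !inE /v trmxK mul_mx_diag !mxE eqxx /=.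
    by case: (i \in S) (i == r) => -[] //; rewrite mulr0 subrr eqxx.
  have v0 : v = 0.
    apply: (k_rank_ker (M := C)).
      apply: leq_trans (subset_leq_card supp_v) _.
      by rewrite cardsU1 !inE rS.
    apply: trmx_inj; rewrite trmx_mul trmxK mulmxBl -rowE def_r mulmxA subrr.
    by rewrite trmx0.
  move/colP/(_ r)/eqP: v0; rewrite /v mxE mul_mx_diag !mxE !eqxx rS mulr0 subr0.
  by rewrite oner_eq0.
case/exists_separating => u Du ru; exists u.
  apply/subsetP => i; rewrite !inE; apply: contraR => iS.
  move/colP/(_ i): Du; rewrite -mulmxA mul_diag_mx !mxE iS mul1r => ->.
  by rewrite eqxx.
apply: contraNneq ru => ru; rewrite -row_mul; apply/eqP/colP => c.
by rewrite ord1 mxE ru mxE.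
Qed.

Lemma factors_of_third_factor (I J K R : nat) (A A' : 'M[F]_(I, R))
    (B B' : 'M[F]_(J, R)) (C : 'M[F]_(K, R)) :
  (forall u : 'cV[F]_K, A *m diag_mx (C^T *m u)^T *m B^T =
                        A' *m diag_mx (C^T *m u)^T *m B'^T) ->
  nonzero_cols B' ->
  (R.+1 <= k_rank A + k_rank C)%N -> (R.+2 <= k_rank B + k_rank C)%N ->
  forall r, exists l : F,
    [/\ l != 0, col r A' = l^-1 *: col r A & col r B' = l *: col r B].
Proof.
move=> eq_pencil nzB' leA leB.
have := k_rank_le B; have := k_rank_le C => leC leBR.
(* The complement of a set of size [s] has [k_rank C - 1] elements, as [exists_vanishing_off]
   requires; the hypotheses say [s <= k_rank A] and [s < k_rank B]. *)
pose s := (R.+1 - k_rank C)%N.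
have vanish (S : {set 'I_R}) r : r \in S -> #|S| = s ->
    exists2 u : 'cV[F]_K, supp (C^T *m u)^T \subset S & (C^T *m u) r 0 != 0.
  move=> rS cS; apply: exists_vanishing_off => //.
  have := cardsC S; rewrite card_ord cS /s; lia.
have card_supp (S : {set 'I_R}) (d : 'rV[F]_R) : supp d \subset S -> #|S| = s ->
    (#|supp d| <= k_rank A)%N /\ (#|supp d| <= k_rank B)%N.
  move=> sS cS; have := subset_leq_card sS; rewrite cS /s => le_s.
  split; lia.
have span (S : {set 'I_R}) r : r \in S -> #|S| = s ->
    exists2 w : 'rV[F]_R, supp w \subset S & (col r B')^T = w *m B^T.
  move=> rS cS; have [u uS ur] := vanish S r rS cS.
  set d := (C^T *m u)^T in uS; have [dA dB] := card_supp S d uS cS.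
  have rankM : \rank (A *m diag_mx d *m B^T) = \rank (diag_mx d).
    rewrite -mulmxA rank_mul_k_rank // -mxrank_tr trmx_mul trmxK tr_diag_mx.
    by rewrite -[diag_mx d in LHS]mulmx1 rank_mul_k_rank // mulmx1.
  (* Both row spaces contain that of the pencil, whose rank is that of [diag_mx d]; neither can be
     larger, so all three agree. *)
  have : (diag_mx d *m B'^T <= diag_mx d *m B^T)%MS.
    apply: (@submx_trans _ _ _ _ _ _ (A *m diag_mx d *m B^T)); last first.
      by rewrite -mulmxA submxMl.
    have sub : (A *m diag_mx d *m B^T <= diag_mx d *m B'^T)%MS.
      by rewrite eq_pencil -mulmxA submxMl.
    by rewrite -(geq_leqif (mxrank_leqif_sup sub)) rankM mxrankM_maxl.
  move/(submx_trans (row_sub r _)); rewrite row_diag_mul.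
  rewrite eqmx_scale; last by rewrite mxE.
  case/submxP => w def_w; exists (w *m diag_mx d).
    apply: subset_trans uS; apply/subsetP => i; rewrite !inE mul_mx_diag mxE.
    by apply: contraNneq => ->; rewrite mulr0.
  by rewrite -mulmxA -def_w tr_col.
have [l lP] : exists l : 'I_R -> F, forall r, col r B' = l r *: col r B.
  apply: (fin_all_exists (P := fun r l => col r B' = l *: col r B)) => r.
  (* Removing any element but [r] from [Q] leaves a set to which [span] applies, while
     [s + 1 <= k_rank B] makes the columns of [B] indexed by [Q] independent. *)
  have [||Q [rQ _ cQ]] := @exists_between_card _ [set r] setT s.+1.
  - exact: subsetT.
  - by rewrite cards1 cardsT card_ord /s; lia.
  rewrite sub1set in rQ.
  have cardQ q : q \in Q -> #|Q :\ q| = s.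
    by move=> qQ; have := cardsD1 q Q; rewrite qQ cQ; lia.
  have [q0] : exists q0, q0 \in Q :\ r.
    by apply/set0Pn; rewrite -card_gt0 cardQ // /s; lia.
  rewrite !inE => /andP[q0r q0Q].
  have [|w w_supp def_r] := span (Q :\ q0) r _ (cardQ _ q0Q).
    by rewrite !inE eq_sym q0r.
  (* Two expansions of [col r B'] along columns of [B] indexed by subsets of
     [Q] agree, so the coefficient at each [i != r] vanishes. *)
  have w0 i : i != r -> w 0 i = 0.
    move=> ir; have [iQ|iQ] := boolP (i \in Q); last first.
      by apply: (supp_notin w_supp); rewrite !inE (negPf iQ) andbF.
    have [|w' w'_supp def_r'] := span (Q :\ i) r _ (cardQ _ iQ).
      by rewrite !inE eq_sym ir.
    have w'i : w' 0 i = 0 by apply: (supp_notin w'_supp); rewrite !inE eqxx.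
    have : (w - w')^T = 0.
      apply: (k_rank_ker (M := B)).
        rewrite trmxK; apply: (@leq_trans #|Q|); last by rewrite cQ /s; lia.
        apply: subset_leq_card; apply/subsetP => k; rewrite !inE.
        apply: contraR => kQ; rewrite !mxE (supp_notin w_supp); last first.
          by rewrite !inE (negPf kQ) andbF.
        by rewrite (supp_notin w'_supp) ?subrr // !inE (negPf kQ) andbF.
      apply: trmx_inj; rewrite trmx_mul trmxK mulmxBl -def_r -def_r' subrr.
      by rewrite trmx0.
    by move/colP/(_ i)/eqP; rewrite !mxE w'i subr0 => /eqP.
  exists (w 0 r); apply: trmx_inj; rewrite def_r; apply/rowP => j.
  rewrite !mxE (bigD1 r) //= big1 ?addr0 => [|i ir]; last by rewrite w0 ?mul0r.
  by rewrite !mxE.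
have l0 r : l r != 0.
  by apply: contraNneq (nzB' r) => l0; rewrite lP l0 scale0r.
move=> r; exists (l r); split=> //.
have [||S [rS _ cS]] := @exists_between_card _ [set r] setT s.
- exact: subsetT.
- by rewrite cards1 cardsT card_ord /s; lia.
rewrite sub1set in rS; have [u uS ur] := vanish S r rS cS.
set d := (C^T *m u)^T in uS; have [_ dB] := card_supp S d uS cS.
(* As [B'] is [B] with scaled columns, the transposed [eq_pencil] reads [B *m (diag_mx d *m X) = 0],
   and [B] is injective on vectors supported in [supp d]. *)
pose X := A^T - diag_mx (\row_k l k) *m A'^T.
have def_B' : B' = B *m diag_mx (\row_k l k).
  apply/matrixP => i k; move/colP/(_ i): (lP k).
  by rewrite mul_mx_diag !mxE mulrC.
have BX : B *m (diag_mx d *m X) = 0.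
  rewrite mulmxBr mulmxBr.
  have := congr1 trmx (eq_pencil u); rewrite -/d !trmx_mul !trmxK tr_diag_mx.
  rewrite !mulmxA => ->; rewrite def_B' -[B *m _ *m diag_mx d]mulmxA.
  by rewrite (diag_mxC _ d) mulmxA subrr.
have : diag_mx d *m X == 0.
  by rewrite -mxrank_eq0 -(rank_mul_k_rank X dB) BX mxrank0.
move/eqP/row_matrixP/(_ r); rewrite row_diag_mul row0 => /eqP.
rewrite scaler_eq0 mxE (negPf ur) /= => /eqP/rowP Xr.
apply/colP => i; have /eqP := Xr i; rewrite /X mul_diag_mx !mxE subr_eq0.
by move=> /eqP ->; rewrite mulKf.
Qed.

End Core.

(** * Contractions and equivalence of decompositions *)

Section Decompositions.
Variables (F : fieldType) (I J K : nat).

(** The right side does not involve the factors, so all decompositions of [T] have the same pencil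
    at each [u]. *)
Lemma pd_pencil (T : tensor F I J K) (R : nat) (A : 'M_(I, R)) (B : 'M_(J, R))
    (C : 'M_(K, R)) (u : 'cV[F]_K) :
  is_pd T A B C ->
  A *m diag_mx (C^T *m u)^T *m B^T = \matrix_(i, j) \sum_k T (i, j, k) * u k 0.
Proof.
case=> _ _ _ ->; apply/matrixP => i j; rewrite mxE_pencil !mxE.
under [RHS]eq_bigr => k _ do rewrite sum_ffunE big_distrl.
rewrite exchange_big; apply: eq_bigr => r _ /=.
rewrite !mxE big_distrl; apply: eq_bigr => k _ /=.
by rewrite ffunE /= !mxE mulrC mulrA.
Qed.

(** Column-wise form of the relation in [cpd_unique]; the scalars are nonzero because their product
    is 1. *)
Definition pd_equiv (R : nat) (A A' : 'M[F]_(I, R)) (B B' : 'M[F]_(J, R))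
    (C C' : 'M[F]_(K, R)) : Prop :=
  exists (s : 'S_R) (a b c : 'I_R -> F), forall r,
    [/\ col r A' = a r *: col (s r) A, col r B' = b r *: col (s r) B,
        col r C' = c r *: col (s r) C & a r * b r * c r = 1].

Lemma pd_equiv_common (R : nat) (A A1 A2 : 'M[F]_(I, R))
    (B B1 B2 : 'M[F]_(J, R)) (C C1 C2 : 'M[F]_(K, R)) :
  pd_equiv A A1 B B1 C C1 -> pd_equiv A A2 B B2 C C2 ->
  pd_equiv A1 A2 B1 B2 C1 C2.
Proof.
case=> s1 [a1 [b1 [c1 E1]]] [s2 [a2 [b2 [c2 E2]]]].
(* Column [t r] of [A1] and column [r] of [A2] come from the same column of [A]. *)
pose t r := (s1^-1)%g (s2 r).
exists (s2 * s1^-1)%g, (fun r => a2 r / a1 (t r)), (fun r => b2 r / b1 (t r)),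
  (fun r => c2 r / c1 (t r)) => r.
have [-> -> -> abc2] := E2 r; have [] := E1 (t r); rewrite permM -/(t r).
have -> : s1 (t r) = s2 r by rewrite /t permKV.
move=> -> -> -> abc1.
have : a1 (t r) * b1 (t r) * c1 (t r) != 0 by rewrite abc1 oner_eq0.
rewrite !mulf_eq0 !negb_or -andbA => /and3P[a0 b0 c0].
rewrite !scalerA !divfK //; split=> //.
by rewrite !mulf_div abc1 abc2 divr1.
Qed.

Lemma pd_equiv_matrices (R : nat) (A A' : 'M[F]_(I, R)) (B B' : 'M[F]_(J, R))
    (C C' : 'M[F]_(K, R)) :
  pd_equiv A A' B B' C C' ->
  exists P LA LB LC : 'M[F]_R,
    [/\ is_perm_mx P,
        [/\ is_diag_mx LA, is_diag_mx LB & is_diag_mx LC],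
        [/\ LA \in unitmx, LB \in unitmx & LC \in unitmx],
        [/\ A' = A *m P *m LA, B' = B *m P *m LB & C' = C *m P *m LC] &
        LA *m LB *m LC = 1%:M].
Proof.
case=> s [a [b [c E]]].
have nz r : [/\ a r != 0, b r != 0 & c r != 0].
  have [_ _ _ abc] := E r.
  have : a r * b r * c r != 0 by rewrite abc oner_eq0.
  by rewrite !mulf_eq0 !negb_or -andbA => /and3P.
pose L (f : 'I_R -> F) := diag_mx (\row_r f r).
have unitL f : (forall r, f r != 0) -> L f \in unitmx.
  move=> f0; rewrite unitmxE unitfE det_diag.
  by apply/prodf_neq0 => r _; rewrite mxE.
have mulL p (M M' : 'M_(p, R)) f :
    (forall r, col r M' = f r *: col (s r) M) ->
    M' = M *m perm_mx s^-1 *m L f.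
  move=> eqM; rewrite -col_permE mul_mx_diag; apply/matrixP => i r.
  by move/colP/(_ i): (eqM r); rewrite !mxE mulrC.
exists (perm_mx s^-1), (L a), (L b), (L c); split.
- exact: perm_mx_is_perm.
- by split; exact: diag_mx_is_diag.
- by split; apply: unitL => r; case: (nz r).
- by split; apply: mulL => r; case: (E r).
- rewrite !mulmx_diag -diag_const_mx; congr diag_mx; apply/rowP => r.
  by have [_ _ _] := E r; rewrite !mxE.
Qed.

End Decompositions.

(** * Minimality and uniqueness of the given decomposition *)

Lemma row_tr_inj (F : fieldType) (K R : nat) (C : 'M[F]_(K, R)) i j :
  (1 < k_rank C)%N -> (row i C^T <= row j C^T)%MS -> i = j.
Proof.
move=> kC /sub_rVP[a eq_ij]; apply/eqP; apply: wlog_neg => ne_ij.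
pose v : 'rV[F]_R := delta_mx 0 i - a *: delta_mx 0 j.
have : v^T = 0.
  apply: (k_rank_ker (M := C)).
    apply: leq_trans kC.
    apply: leq_trans (_ : #|[set i; j]| <= 2)%N; last first.
      by rewrite cards2; case: (i != j).
    rewrite trmxK; apply/subset_leq_card/subsetP => k.
    rewrite !inE !mxE eqxx /=; apply: contraR.
    by rewrite negb_or => /andP[/negPf-> /negPf->]; rewrite mulr0 subrr.
  apply: trmx_inj; rewrite trmx_mul trmxK mulmxBl -scalemxAl -!rowE eq_ij.
  by rewrite subrr trmx0.
move/colP/(_ i)/eqP; rewrite !mxE !eqxx (negPf ne_ij) mulr0 subr0.
by rewrite oner_eq0.
Qed.

(** Otherwise the nonzero column 0 would span column 1, against [row_tr_inj]. Rank above 1 makes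
    lines proper flats in [Kruskal_permutation]. *)
Lemma rank_gt1 (F : fieldType) (K R : nat) (C : 'M[F]_(K, R)) :
  (1 < k_rank C)%N -> nonzero_cols C -> (1 < \rank C^T)%N.
Proof.
move=> kC nzC; have R2 := leq_trans kC (k_rank_le C).
rewrite ltnNge; apply/negP => rC.
pose r0 := Ordinal (ltnW R2); pose r1 := Ordinal R2.
have sub : (C^T <= row r0 C^T)%MS.
  rewrite -(geq_leqif (mxrank_leqif_sup (row_sub r0 C^T))).
  apply: leq_trans rC _; rewrite rank_rV -tr_col.
  by rewrite -[in _^T != _]trmx0 (inj_eq trmx_inj) nzC.
by have := row_tr_inj kC (submx_trans (row_sub r1 _) sub).
Qed.

Theorem corollary1p23 (F : fieldType) (hF : real_or_complex F)
    (I J K R : nat)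
    (A : 'M[F]_(I, R)) (B : 'M[F]_(J, R)) (C : 'M[F]_(K, R))
    (T : tensor F I J K) (hT : is_pd T A B C)
    (m : nat) (hm : m = (R - \rank C + 2)%N)
    (hi : (R%:Z + 1 <=
           Num.max (Num.min (k_rank A)%:Z ((k_rank B)%:Z - 1))
                   (Num.min ((k_rank A)%:Z - 1) (k_rank B)%:Z)
           + (k_rank C)%:Z)%R)
    (hmA : (m <= minn I R)%N) (hmB : (m <= minn J R)%N)
    (hii : forall d : 'cV[F]_R,
       khatri_rao (compound m A) (compound m B) *m hat m d = 0 ->
       hat m d = 0) :
  has_rank T R /\ cpd_unique T.
Proof.
have [kA [kB kC]] := (k_rank_le A, (k_rank_le B, k_rank_le C)).
(* The two arguments of the maximum give two cases, exchanged by swapping [A] and [B]. *)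
have hk :
    (R.+1 <= k_rank A + k_rank C /\ R.+2 <= k_rank B + k_rank C)%N \/
    (R.+1 <= k_rank B + k_rank C /\ R.+2 <= k_rank A + k_rank C)%N.
  by move: hi; rewrite maxEle !minEle; do ![case: ifP => ?] => hi; lia.
have kC2 : (1 < k_rank C)%N by case: hk => -[]; lia.
have le_mR : (m <= R)%N by apply: leq_trans hmA _; rewrite geq_minr.
have [nzA nzB nzC _] := hT.
have nz_row n (M : 'M[F]_(K, n)) : nonzero_cols M -> forall r, row r M^T != 0.
  by move=> nzM r; rewrite -tr_col -trmx0 (inj_eq trmx_inj).
have rC := rank_gt1 kC2 nzC.
rewrite -mxrank_tr in hm.
have supp_le n A' B' (C' : 'M_(K, n)) : is_pd T A' B' C' ->
    forall u : 'cV_K, (minn #|supp (C^T *m u)^T| m <= #|supp (C'^T *m u)^T|)%N.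
  move=> hT' u; apply: leq_trans (rank_pencil_ge _ le_mR hii) _.
  rewrite (pd_pencil u hT) -(pd_pencil u hT').
  apply: leq_trans (rank_diag_le _).
  exact: leq_trans (mxrankM_maxl _ _) (mxrankM_maxr _ _).
have rank_min n A' B' (C' : 'M_(K, n)) : is_pd T A' B' C' -> (R <= n)%N.
  move=> hT'; have [//|lt_nR] := leqP R n.
  have [_ _ nzC' _] := hT'.
  have := size_permutation hm (supp_le _ _ _ _ hT') (ltnW lt_nR) (ltnW rC).
  move=> /(_ (nz_row _ _ nzC) (nz_row _ _ nzC')) eq_nR.
  by rewrite eq_nR ltnn in lt_nR.
have hR : has_rank T R by split; [exists A, B, C | exact: rank_min].
split=> // n [_ n_min] A1 A2 B1 B2 C1 C2 h1 h2; apply: pd_equiv_matrices.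
have eq_nR : n = R.
  by apply/eqP; rewrite eqn_leq (n_min _ _ _ _ hT) (rank_min _ _ _ _ h1).
move: A1 A2 B1 B2 C1 C2 h1 h2; rewrite eq_nR => A1 A2 B1 B2 C1 C2.
suff equiv A' B' C' : is_pd T A' B' C' -> pd_equiv A A' B B' C C'.
  by move=> /equiv E1 /equiv E2; exact: pd_equiv_common E1 E2.
move=> hT'; have [nzA' nzB' nzC' _] := hT'.
have [s sP] := Kruskal_permutation hm (supp_le _ _ _ _ hT') rC
  (nz_row _ _ nzC) (nz_row _ _ nzC') (fun i j => row_tr_inj kC2).
have {sP} /fin_all_exists[c cP] j : exists c : F,
    c != 0 /\ col j C' = c *: col (s j) C.
  have [c c0 eqc] := sP j; exists c; split=> //.
  by apply: trmx_inj; rewrite linearZ /= !tr_col.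
(* The decomposition [A', B', C'], with its terms permuted and the scalars of
   [C'] moved to [A'], so that its third factor becomes [C]. *)
pose A'' := \matrix_(i, r) (c (s^-1 r)%g * A' i (s^-1 r)%g).
pose B'' := \matrix_(i, r) B' i (s^-1 r)%g.
have colA r : col (s r) A'' = c r *: col r A'.
  by apply/colP => i; rewrite !mxE permK.
have colB r : col (s r) B'' = col r B'.
  by apply/colP => i; rewrite !mxE permK.
have eq_pencil (u : 'cV_K) : A *m diag_mx (C^T *m u)^T *m B^T =
    A'' *m diag_mx (C^T *m u)^T *m B''^T.
  rewrite (pd_pencil u hT) -(pd_pencil u hT'); apply/matrixP => i j.
  rewrite !mxE_pencil [RHS](reindex_inj (@perm_inj _ s)).
  apply: eq_bigr => r _ /=; rewrite !mxE permK.
  suff -> : \sum_k C'^T r k * u k 0 = c r * \sum_k C^T (s r) k * u k 0.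
    by rewrite -!mulrA mulrCA.
  rewrite big_distrr; apply: eq_bigr => k _ /=; rewrite mulrA; congr (_ * _).
  by have [_ /colP/(_ k)] := cP r; rewrite !mxE.
have nzA'' : nonzero_cols A''.
  move=> r; rewrite -[r](permKV s) colA scaler_eq0 negb_or nzA' andbT.
  by case: (cP ((s^-1)%g r)).
have nzB'' : nonzero_cols B''.
  by move=> r; rewrite -[r](permKV s) colB.
have /fin_all_exists[l lP] : forall r, exists l : F,
    [/\ l != 0, col r A'' = l^-1 *: col r A & col r B'' = l *: col r B].
  case: hk => -[h1 h2].
    exact: factors_of_third_factor eq_pencil nzB'' h1 h2.
  (* The second case swaps [A] and [B] by transposing the pencil, which inverts [l]. *)
  have eq_pencil_tr (u : 'cV_K) : B *m diag_mx (C^T *m u)^T *m A^T =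
      B'' *m diag_mx (C^T *m u)^T *m A''^T.
    have := congr1 trmx (eq_pencil u).
    by rewrite !trmx_mul !trmxK tr_diag_mx !mulmxA.
  move=> r; have [l [l0 eqB eqA]] :=
    factors_of_third_factor eq_pencil_tr nzA'' h1 h2 r.
  by exists l^-1; rewrite invr_eq0 invrK.
(* The factor [(c r)^-1] undoes the scaling by [c r] that [A''] received. *)
exists s, (fun r => (c r)^-1 / l (s r)), (fun r => l (s r)), c => r.
have [c0 eqC] := cP r; have [l0 eqA eqB] := lP (s r).
split=> //; first 1 last.
- by rewrite -colB.
- by rewrite divfK // mulVf.
by rewrite -scalerA -eqA colA scalerA mulVf ?scale1r.
Qed.
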